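(* Let $k\ge 2$ and let $a_1,a_2,\dots,a_k$ be positive integers with $\gcd(a_1,a_2,\dots,a_k)=1$. Then there exists an integer $G$ such that every integer $n>G$ can be written as $$n=a_1x_1+a_2x_2+\cdots+a_kx_k,\qquad x_1,\dots,x_k\in\mathbb{Z}_{\ge 0},\ \gcd(x_1,\dots,x_k)=1.$$ In other words, the least such integer $G_{a_1,\dots,a_k}$ is finite (well defined).
   Context: $G_{a_1,\dots,a_k}$ denotes the least integer such that every integer $n>G_{a_1,\dots,a_k}$ has a representation $n=a_1x_1+\cdots+a_kx_k$ with all $x_i$ nonnegative integers and $\gcd(x_1,\dots,x_k)=1$. *)

(* Defs.v *)
From mathcomp Require Import all_boot all_order all_algebra.

Set Implicit Arguments.
Unset Strict Implicit.
Unset Printing Implicit Defensive.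

Local Open Scope ring_scope.

(* Iterated gcd of a finite family; 0 is the neutral element of gcdn. *)
Definition gcdn_family (k : nat) (x : 'I_k -> nat) : nat :=
  \big[gcdn/0%N]_(i < k) x i.

Definition primitively_representable (k : nat) (a : 'I_k -> nat) (n : int) : Prop :=
  exists x : 'I_k -> nat,
    n = \sum_(i < k) (a i)%:Z * (x i)%:Z /\ gcdn_family x = 1%N.

Definition primitive_bound (k : nat) (a : 'I_k -> nat) (G : int) : Prop :=
  forall n : int, G < n -> primitively_representable a n.

(* [is_primitive_frobenius a G] means G = G_{a_1,...,a_k}. *)
Definition is_primitive_frobenius (k : nat) (a : 'I_k -> nat) (G : int) : Prop :=
  primitive_bound a G /\ forall G' : int, primitive_bound a G' -> G <= G'.

(* Main.v *)
Require Import Defs.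
From mathcomp Require Import all_boot all_order all_algebra.
From mathcomp Require Import boolp zify.

Set Implicit Arguments.
Unset Strict Implicit.
Unset Printing Implicit Defensive.

Import Order.TTheory.

(** For two coprime coefficients [a], [b], the representations of [n] are
    [(x0 + b t, y0 - a t)] with about [n / (a b)] admissible values of [t].  The
    gcd of such a pair divides [n], and each prime [p] dividing [n] divides both
    entries only for [t] in a single class modulo [p].  If [t] avoids the
    forbidden classes of a set of primes with product [m], then so does [t + m],
    and for a further prime [p] one of [t], [t + m] avoids its forbidden class.
    Hence some [t < 2 m] is admissible for all primes, where [m <= n / p]
    whenever a prime [p] divides [n]: this is small enough as soon as [n] has a
    prime factor [p >= 2 a b], while if all prime factors of [n] are below
    [2 a b] a bounded [t] suffices.  More coefficients are handled by induction,
    writing [n = d u + a_k v] with [d] the gcd of the first [k - 1] coefficients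
    and [v < d]. *)

Lemma dvdn_prod_primes (n : nat) (s : seq nat) :
  uniq s -> all prime s -> all (dvdn^~ n) s -> \prod_(p <- s) p %| n.
Proof.
elim: s => [|p s IHs]; first by rewrite big_nil dvd1n.
move=> /= /andP[ps us] /andP[pp prs] /andP[pn sn]; rewrite big_cons.
have cop : coprime p (\prod_(q <- s) q).
  rewrite prime_coprime // Euclid_dvd_prod // big_has; apply/hasPn => q qs.
  rewrite dvdn_prime2 //; last exact: (allP prs).
  by apply: contraNneq ps => ->.
by rewrite Gauss_dvd // pn IHs.
Qed.

Definition one_class_each (bad : nat -> nat -> bool) : Prop :=
  forall p t u, prime p -> bad p t -> bad p (t + u) -> p %| u.

(** The head [p] stays out of the product in the bound; this saving is what lets one large prime
    factor pay for the constant [K] later. *)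
Lemma sieve_cons (bad : nat -> nat -> bool) (p : nat) (s : seq nat) :
    one_class_each bad ->
    (forall q t u, q %| u -> bad q (t + u) = bad q t) ->
    uniq (p :: s) -> all prime (p :: s) ->
  exists2 t, t < 2 * \prod_(q <- s) q & {in p :: s, forall q, ~~ bad q t}.
Proof.
move=> bad1 badD; elim: s p => [|r s IHs] p.
  move=> _ /= /andP[pp _]; rewrite big_nil.
  case b0: (bad p 0); last by exists 0 => // q /[!inE] /eqP ->; rewrite b0.
  exists 1 => // q /[!inE] /eqP ->; apply/negP => b1.
  by have := bad1 p 0 1 pp b0 b1; rewrite dvdn1 => /eqP p1; rewrite p1 in pp.
rewrite cons_uniq => /andP[prs urs] /= /andP[pp ars].
have [t ltt goodt] := IHs r urs ars.
set m := \prod_(q <- r :: s) q.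
(* As [r >= 2], the inductive bound is at most [m], so both [t] and [t + m] lie below [2 * m]. *)
have ltm : t < m.
  apply: leq_trans ltt _; rewrite /m big_cons leq_mul2r.
  by apply/orP; right; apply: prime_gt1; case/andP: ars.
have goodm : {in r :: s, forall q, ~~ bad q (t + m)}.
  move=> q qs; rewrite badD ?goodt // /m.
  by rewrite (big_rem q) //= dvdn_mulr.
have pm : ~~ (p %| m).
  rewrite /m Euclid_dvd_prod // big_has; apply/hasPn => q qs.
  have prq : prime q by apply: (allP (_ : all prime (r :: s))).
  by rewrite dvdn_prime2 //; apply: contraNneq prs => ->.
case bt: (bad p t).
  exists (t + m); first by lia.
  move=> q /[!(in_cons p)] /orP[/eqP ->|qs].
    by apply: contra pm => /(bad1 _ _ _ pp bt).
  exact: goodm.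
exists t; first by lia.
by move=> q /[!(in_cons p)] /orP[/eqP ->|/goodt //]; rewrite bt.
Qed.

Lemma sieve_prime_divisors (K : nat) :
  exists N, forall (bad : nat -> nat -> bool) (n : nat),
    one_class_each bad ->
    (forall q t u, q %| u -> bad q (t + u) = bad q t) ->
    N <= n -> 0 < n ->
    exists2 t, K * t.+1 <= n & {in primes n, forall p, ~~ bad p t}.
Proof.
(* With [2] put in front as head, this list contains every prime below [2 * K]. *)
pose s := [seq p <- iota 3 (2 * K) | prime p].
exists (K * (2 * \prod_(q <- s) q)) => bad n bad1 badD leNn n0.
have [/hasP[p pn leKp]|/hasPn small] := boolP (has (leq (2 * K)) (primes n)).
  pose r := rem p (primes n).
  have perm_pr : perm_eq (primes n) (p :: r) by apply: perm_to_rem.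
  have upr : uniq (p :: r) by rewrite -(perm_uniq perm_pr) primes_uniq.
  have prp : all prime (p :: r).
    rewrite -(perm_all _ perm_pr); apply/allP => q.
    by rewrite mem_primes => /and3P[].
  have dvp : all (dvdn^~ n) (p :: r).
    rewrite -(perm_all _ perm_pr); apply/allP => q.
    by rewrite mem_primes => /and3P[].
  have [t ltt goodt] := sieve_cons bad1 badD upr prp.
  exists t; last by move=> q; rewrite (perm_mem perm_pr) => /goodt.
  (* Here [K * t.+1 <= 2 * K * \prod_(q <- r) q <= p * \prod_(q <- r) q], a divisor of [n]. *)
  apply: leq_trans (dvdn_leq n0 (dvdn_prod_primes upr prp dvp)).
  rewrite big_cons; apply: leq_trans (leq_mul leKp (leqnn _)).
  by rewrite (mulnC 2) -mulnA leq_mul2l ltt orbT.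
have us : uniq (2 :: s).
  by rewrite /= filter_uniq ?iota_uniq // mem_filter mem_iota.
have ps : all prime (2 :: s) by rewrite /=; apply: filter_all.
have [t ltt goodt] := sieve_cons bad1 badD us ps.
exists t; first by apply: leq_trans leNn; rewrite leq_mul2l ltt orbT.
move=> p pn; apply: goodt; have := small p pn.
move: pn; rewrite mem_primes => /andP[pp _] ltp; have := prime_gt1 pp.
rewrite in_cons mem_filter mem_iota pp; lia.
Qed.

Lemma bezout_nat (a b n : nat) : 0 < a -> gcdn a b %| n -> a * b <= n ->
  exists u v, v < a /\ n = a * u + b * v.
Proof.
move=> a0 /dvdnP[q nE] leabn.
have [c _ dvc] := Bezoutl b a0.
(* Modulo [a], [c * b] is minus the gcd; the factor [a.-1] acts as -1, so that [b * v] is congruent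
   to [n]. *)
pose v := (a.-1 * c * q) %% a.
have ltv : v < a by rewrite ltn_mod.
have lebv : b * v <= n.
  by apply: leq_trans leabn; rewrite mulnC leq_mul2r ltnW ?orbT.
have dva : a %| n - b * v.
  rewrite -eqn_mod_dvd // modnMmr -(eqn_modDr (b * (c * q))).
  have -> : b * (a.-1 * c * q) + b * (c * q) = a * (b * c * q).
    by case: (a) a0 => // a' _ /=; lia.
  rewrite modnMr; have -> : n + b * (c * q) = (gcdn a b + c * b) * q by lia.
  by apply: dvdn_mulr.
by exists ((n - b * v) %/ a), v; split => //; rewrite mulnC divnK // subnK.
Qed.

Lemma primitive_pair (a b : nat) : 0 < a -> 0 < b -> coprime a b ->
  exists N, forall n, N <= n ->
    exists x y, n = a * x + b * y /\ gcdn x y = 1.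
Proof.
move=> a0 b0 cab; have [N sieveN] := sieve_prime_divisors (a * b).
exists (N + a * b) => n len.
have n0 : 0 < n by nia.
have [||y0 [x0 [ltx nE]]] := @bezout_nat b a n b0.
- by rewrite gcdnC (eqP cab) dvd1n.
- by rewrite mulnC; lia.
(* Both entries are divisible by [p]; the congruence avoids truncated subtraction in
   [y0 - a * t]. *)
pose bad p t := (p %| x0 + b * t) && (y0 == a * t %[mod p]).
have bad1 : one_class_each bad.
  move=> p t u pp /andP[xt yt] /andP[xu yu].
  have pbu : p %| b * u by move: xu; rewrite mulnDr addnA dvdn_addr.
  have pau : p %| a * u.
    move: yu; rewrite (eqP yt) mulnDr -{1}(addn0 (a * t)) eqn_modDl.
    by rewrite mod0n eq_sym.
  move: pbu; rewrite Euclid_dvdM // => /orP[pb|//].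
  move: pau; rewrite Euclid_dvdM // => /orP[pa|//].
  have : p %| gcdn a b by rewrite dvdn_gcd pa.
  by rewrite (eqP cab) dvdn1 => /eqP p1; rewrite p1 in pp.
have badD q t u : q %| u -> bad q (t + u) = bad q t.
  move=> qu; rewrite /bad !mulnDr addnA dvdn_addl ?dvdn_mull //.
  by rewrite -(modnDmr (a * t)) (eqP (dvdn_mull a qu)) addn0.
have [|t let_ goodt] := sieveN bad n bad1 badD _ n0; first by lia.
(* From [a * b * t.+1 <= n] and [x0 < b]: the successor absorbs the term [a * x0]. *)
have lety : a * t <= y0.
  by rewrite -(leq_pmul2l b0); nia.
exists (x0 + b * t), (y0 - a * t); split; first by nia.
set g := gcdn _ _; apply/eqP; apply/negPn/negP => g1.
have gn : g %| n.
  have -> : n = a * (x0 + b * t) + b * (y0 - a * t) by nia.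
  by rewrite dvdn_add // dvdn_mull // (dvdn_gcdl, dvdn_gcdr).
have g_gt1 : 1 < g by have := dvdn_gt0 n0 gn; lia.
have pp := pdiv_prime g_gt1; have pg := pdiv_dvd g.
have pn : pdiv g \in primes n by rewrite mem_primes pp n0 (dvdn_trans pg gn).
move/negP: (goodt _ pn); apply; apply/andP; split.
  by apply: dvdn_trans pg _; apply: dvdn_gcdl.
by rewrite eqn_mod_dvd //; apply: dvdn_trans pg _; apply: dvdn_gcdr.
Qed.

(** Coprimality is relaxed to divisibility of [n] by the gcd, since dropping a coefficient may leave
    a family with a common factor. *)
Lemma primitive_family (k : nat) (a : 'I_k.+2 -> nat) :
  (forall i, 0 < a i) ->
  exists N, forall n, N <= n -> gcdn_family a %| n ->
    exists2 x : 'I_k.+2 -> nat,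
      n = \sum_(i < k.+2) a i * x i & gcdn_family x = 1.
Proof.
rewrite /gcdn_family; elim: k a => [|k IHk] a a_gt0.
  rewrite 2!big_ord_recr big_ord0 /= gcd0n; set b := a _; set c := a _.
  have b0 : 0 < b by apply: a_gt0.
  have c0 : 0 < c by apply: a_gt0.
  have d0 : 0 < gcdn b c by rewrite gcdn_gt0 b0.
  set d := gcdn b c in d0 *.
  have bE : b = b %/ d * d by rewrite divnK ?dvdn_gcdl.
  have cE : c = c %/ d * d by rewrite divnK ?dvdn_gcdr.
  have [|||N HN] := @primitive_pair (b %/ d) (c %/ d).
  - by rewrite divn_gt0 // dvdn_leq ?dvdn_gcdl.
  - by rewrite divn_gt0 // dvdn_leq ?dvdn_gcdr.
  - by rewrite /coprime -(eqn_pmul2r d0) muln_gcdl -bE -cE mul1n.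
  exists (N * d) => n leN dn.
  have [|x [y [nE gxy]]] := HN (n %/ d); first by rewrite leq_divRL.
  exists (fun i => if i == ord0 then x else y).
    rewrite 2!big_ord_recr big_ord0 /= add0n -/b -/c.
    rewrite -(divnK dn) nE {2}bE {2}cE; lia.
  by rewrite 2!big_ord_recr big_ord0 /= gcd0n.
have widenE (i : 'I_k.+2) : widen_ord (leqnSn k.+2) i = lift ord_max i.
  by apply: val_inj; rewrite /= /bump leqNgt ltn_ord.
pose a' (i : 'I_k.+2) := a (widen_ord (leqnSn _) i).
have [N HN] := IHk a' (fun i => a_gt0 _).
rewrite big_ord_recr /=; set d := \big[gcdn/0]_(i < k.+2) _; set c := a _.
have d0 : 0 < d.
  by rewrite /d big_ord_recl gcdn_gt0 a_gt0.
(* Since [v < d], the term [d * c] covers [c * v] and leaves [d * u >= N]. *)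
exists (N + d * c) => n leN dn.
have [|u [v [ltv nE]]] := bezout_nat d0 dn; first by lia.
have [||x xE gx] := HN (d * u); first by nia.
  by apply: dvdn_mulr.
exists (fun i => if unlift ord_max i is Some j then x j else v).
  rewrite big_ord_recr /= unlift_none nE xE -/c; congr (_ + _).
  by apply: eq_bigr => i _; rewrite /a' widenE liftK.
(* The first entries already have gcd 1, so adjoining [v] keeps it. *)
rewrite big_ord_recr /= unlift_none -[RHS](gcd1n v) -gx; congr gcdn.
by apply: eq_bigr => i _; rewrite widenE liftK.
Qed.

Lemma primitive_bound_exists (k : nat) (a : 'I_k -> nat) :
  1 < k -> (forall i, 0 < a i) -> gcdn_family a = 1 ->
  exists N : nat, primitive_bound a N%:Z.
Proof.
case: k a => [|[|k]] // a _ a_gt0 ga.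
have [N HN] := primitive_family a_gt0.
exists N => -[n|n] ltNn; last by lia.
have [||x nE gx] := HN n; [by lia | by rewrite ga dvd1n |].
exists x; split=> //; rewrite nE (big_morph Posz PoszD (erefl _)).
by apply: eq_bigr => i _; rewrite PoszM.
Qed.

(* [0] only has the zero representation, whose gcd is [0]. *)
Lemma primitive_bound_ge0 (k : nat) (a : 'I_k -> nat) (G : int) :
  (forall i, 0 < a i) -> primitive_bound a G -> (0 <= G)%R.
Proof.
move=> a_gt0 bG; rewrite leNgt; apply/negP => /bG[x [xE gx]].
have : \sum_(i < k) a i * x i = 0.
  apply/eqP; rewrite -eqz_nat (big_morph Posz PoszD (erefl _)).
  by apply/eqP; rewrite [RHS]xE; apply: eq_bigr => i _; rewrite PoszM.
move/eqP; rewrite sum_nat_eq0 => /forallP x0; move: gx; rewrite /gcdn_family.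
rewrite big1 // => i _; have := x0 i; have := a_gt0 i.
by rewrite muln_eq0; lia.
Qed.

Theorem theorem1 (k : nat) (a : 'I_k -> nat)
    (hk : (2 <= k)%N)
    (ha : forall i : 'I_k, (0 < a i)%N)
    (hgcd : gcdn_family a = 1%N) :
  (exists G : int, primitive_bound a G) /\
  (exists! G : int, is_primitive_frobenius a G).
Proof.
have [N bN] := primitive_bound_exists hk ha hgcd.
split; first by exists N%:Z%R.
(* Bounds are nonnegative, so the least one can be sought among the naturals. *)
have exP : exists n : nat, `[< primitive_bound a n%:Z%R >].
  by exists N; apply/asboolP.
have [m /asboolP bm minm] := ex_minnP exP.
have lem G : primitive_bound a G -> (m%:Z <= G)%R.
  move=> bG; have := primitive_bound_ge0 ha bG; case: G bG => // n bn _.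
  by rewrite lez_nat minm //; apply/asboolP.
exists m%:Z%R; split; first by split.
move=> G [bG minG]; apply/eqP; rewrite eq_le lem //=.
exact: minG.
Qed.
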